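(* Let $n\ge 1$ and $k\in\{1,\dots,n\}$. For all $\lambda\in\lambda(\mathcal{S}^{n,k})$ and all $\lambda^+\in\mathbb{R}^n_{\ge 0}$, the sum $\lambda+\lambda^+$ is in $\lambda(\mathcal{S}^{n,k})$.
   Context: $\mathrm{Sym}_n$ denotes the space of $n\times n$ real symmetric matrices. A matrix in $\mathrm{Sym}_n$ is positive semidefinite (PSD) if all its eigenvalues are nonnegative. For $k\in\{1,\dots,n\}$, $\mathcal{S}^{n,k}$ denotes the set of matrices $X\in\mathrm{Sym}_n$ all of whose $k\times k$ principal submatrices are positive semidefinite; such matrices are called $k$-locally PSD. For $X\in\mathrm{Sym}_n$, $\lambda_1(X)\ge\dots\ge\lambda_n(X)$ are the eigenvalues of $X$ in decreasing order, counted with multiplicity, and for a permutation $\sigma\in S_n$ of $\{1,\dots,n\}$ one writes $\lambda(X)^\sigma=(\lambda_{\sigma_1}(X),\dots,\lambda_{\sigma_n}(X))$. Then $\lambda(\mathcal{S}^{n,k})=\{\lambda(X)^\sigma : X\in\mathcal{S}^{n,k},\ \sigma\in S_n\}\subset\mathbb{R}^n$. $\mathbb{R}^n_{\ge 0}$ is the set of vectors in $\mathbb{R}^n$ with nonnegative entries. *)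

(* Defs.v *)
From mathcomp Require Import all_boot all_order all_fingroup all_algebra.
From mathcomp Require Import polyrcf classical_sets reals.

Set Implicit Arguments.
Unset Strict Implicit.
Unset Printing Implicit Defensive.

Import Order.TTheory GRing.Theory Num.Theory.
Local Open Scope ring_scope.
Local Open Scope classical_set_scope.

Definition psd (R : realType) (n : nat) (A : 'M[R]_n) : Prop :=
  A \is symmetricmx /\ forall a : R, eigenvalue A a -> 0 <= a.

(* [enum_val] lists the elements of [I] in increasing order. *)
Definition principal_submx (R : realType) (n : nat) (I : {set 'I_n})
    (X : 'M[R]_n) : 'M[R]_#|I| :=
  mxsub (@enum_val _ (mem I)) (@enum_val _ (mem I)) X.

Definition locally_psd (R : realType) (n k : nat) : set 'M[R]_n :=
  [set X | X \is symmetricmx /\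
           forall I : {set 'I_n}, #|I| = k -> psd (principal_submx I X)].

(* All real eigenvalues, repeated according to their multiplicity in the
   characteristic polynomial; a symmetric matrix of size n has exactly n. *)
Definition eigenvalue_seq (R : realType) (n : nat) (X : 'M[R]_n) : seq R :=
  sort >=%R (flatten [seq nseq (mup a (char_poly X)) a
                     | a <- rootsR (char_poly X)]).

(* Junk value: on a nonsymmetric matrix with fewer than n real eigenvalues,
   the missing entries are 0. *)
Definition eigenvalues (R : realType) (n : nat) (X : 'M[R]_n) : 'rV[R]_n :=
  \row_(i < n) (eigenvalue_seq X)`_i.

Definition eigenvalue_set (R : realType) (n : nat) (S : set 'M[R]_n) :
    set 'rV[R]_n :=
  [set l | exists (X : 'M[R]_n) (s : 'S_n),
             S X /\ l = \row_(i < n) eigenvalues X 0 (s i)].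

Definition nonneg_orthant (R : realType) (n : nat) : set 'rV[R]_n :=
  [set v | forall i : 'I_n, 0 <= v 0 i].

(* Main.v *)
Require Import Defs.
From mathcomp Require Import all_boot all_order all_fingroup all_algebra.
From mathcomp Require Import polyrcf classical_sets reals.
From mathcomp Require Import complex ring.

Set Implicit Arguments.
Unset Strict Implicit.
Unset Printing Implicit Defensive.

Local Open Scope ring_scope.
Import Order.TTheory GRing.Theory Num.Theory.

(** The idea is to keep the eigenvectors and raise the eigenvalues.  Diagonalise
    the given matrix [X] orthogonally as [P^T *m diag_mx d *m P]
    ([orthogonal_diagonalization]), where the entries of [d] are the
    eigenvalues of [X], hence the entries of [l] in another order.  Let [e] be
    [lp] in the order of [d], and replace [d] by [d + e].  This adds
    [P^T *m diag_mx e *m P] to [X], a positive semidefinite matrix because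
    [e] is nonnegative ([psd_congr_diag]), and adding a positive semidefinite
    matrix keeps every principal submatrix positive semidefinite
    ([locally_psdD]).  The eigenvalues of the new matrix are the entries of
    [d + e] ([eigenvalues_orthogonal]), which are those of [l + lp].

    The real spectral theorem is obtained from the complex one only as far as
    the existence of one real eigenvalue goes; an eigenvector is then split
    off with a Householder reflection.  The spectral theorem is also what
    turns positive semidefiniteness, defined by eigenvalues, into
    nonnegativity of the quadratic form ([psdP]), and this form of it is
    additive and passes to principal submatrices. *)

(** * Symmetric matrices and sums of squares *)

Lemma symmetricmxP (F : fieldType) (n : nat) (A : 'M[F]_n) :
  reflect (A^T = A) (A \is symmetricmx).
Proof.
by apply: (iffP (is_hermitianmxP _ _ _)); rewrite expr0 scale1r map_mx_id.
Qed.

Lemma sqnormE (R : comNzRingType) (n : nat) (u : 'rV[R]_n) :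
  (u *m u^T) 0 0 = \sum_j u 0 j ^+ 2.
Proof. by rewrite mxE; apply: eq_bigr => j _; rewrite [in LHS]mxE expr2. Qed.

Lemma sqnorm_gt0 (R : realDomainType) (n : nat) (u : 'rV[R]_n) :
  u != 0 -> 0 < (u *m u^T) 0 0.
Proof.
have ge0 (j : 'I_n) : true -> 0 <= u 0 j ^+ 2 by rewrite sqr_ge0.
rewrite sqnormE lt_def sumr_ge0 // andbT.
apply: contra_neq => /psumr_eq0P u0; apply/rowP => i; rewrite [RHS]mxE.
by apply/eqP; rewrite -sqrf_eq0 u0.
Qed.

(** * The real spectral theorem *)

(** Over the complex numbers [A] is hermitian, so its spectral diagonal is
    real; the characteristic polynomial has real coefficients, so a real root
    of its complexification is one of [A]. *)
Lemma symmetric_has_eigenvalue (R : rcfType) (n : nat) (A : 'M[R]_n.+1) :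
  A^T = A -> exists a, eigenvalue A a.
Proof.
move=> symA; pose B := map_mx (real_complex R) A.
have hermB : B \is hermsymmx.
  apply/is_hermitianmxP; rewrite expr0 scale1r.
  apply/matrixP => i j; rewrite !mxE -[in LHS]symA mxE.
  by apply/esym/CrealP/complex_realP; exists (A j i).
have /orthomx_spectralP specB := hermitian_normalmx hermB.
have /mxOverP/(_ 0 0)/complex_realP[a Da] := hermitian_spectral_diag_real hermB.
set P := spectralmx B in specB; set D := spectral_diag B in specB Da.
have Pu : P \in unitmx by apply: spectral_unit.
exists a; rewrite eigenvalue_root_char -(fmorph_root (real_complex R)).
rewrite map_char_poly -eigenvalue_root_char; apply/eigenvalueP.
exists (row 0 P); last first.
  apply: contraTneq Pu => P0.
  rewrite unitmxE (expand_det_row _ 0) big1 ?unitr0 //.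
  by move=> j _; move/rowP/(_ j): P0; rewrite !mxE => ->; rewrite mul0r.
rewrite -/B {1}specB -row_mul !mulmxA mulmxV // mul1mx.
transitivity (D 0 0 *: row 0 P); last by rewrite Da.
by rewrite row_mul row_diag_mx -scalemxAl -rowE.
Qed.

(** The reflection in the hyperplane orthogonal to [w], where [w] is the
    difference of the first basis vector and [v], exchanges these two unit
    vectors. *)
Lemma orthogonal_with_first_row (R : realFieldType) (n : nat)
    (v : 'rV[R]_n.+1) :
  v *m v^T = 1%:M ->
  exists P : 'M[R]_n.+1, P *m P^T = 1%:M /\ row 0 P = v.
Proof.
move=> v1; pose w := delta_mx 0 0 - v; have [w0|wn0] := eqVneq w 0.
  exists 1%:M; rewrite trmx1 mulmx1; split=> //.
  by move/eqP: w0; rewrite subr_eq0 => /eqP<-; rewrite rowE mulmx1.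
pose c := (w *m w^T) 0 0; pose k := 2 / c.
have cE : c = 2 * (1 - v 0 0).
  rewrite /c /w linearB /= mulmxBl !mulmxBr trmx_delta mul_delta_mx.
  rewrite v1 -rowE -colE !mxE eqxx /=; ring.
have cn0 : c != 0 by rewrite gt_eqF // sqnorm_gt0.
(* From here on only [c != 0] and these two equations are used of [w]; with
   its body visible, [mulmxBr] would distribute over the difference in it. *)
have w00 : w 0 0 = c / 2 by rewrite cE !mxE eqxx /= mulrC mulKf // pnatr_eq0.
have wE : delta_mx 0 0 - w = v by rewrite /w opprB addrC subrK.
clearbody w; have kc : k * c = 2 by rewrite /k divfK.
pose H : 'M[R]_n.+1 := 1%:M - k *: (w^T *m w).
have HT : H^T = H.
  by rewrite /H linearB linearZ /= trmx1 trmx_mul trmxK.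
exists H; rewrite HT; split.
  have ww : w *m w^T = c%:M by rewrite [LHS]mx11_scalar.
  rewrite {1}/H mulmxBl mul1mx -scalemxAl /H mulmxBr mulmx1 -scalemxAr.
  rewrite [w^T *m w *m _]mulmxA -[w^T *m w *m _]mulmxA ww mul_mx_scalar.
  rewrite -scalemxAl.
  rewrite scalerBr !scalerA -mulrA kc.
  by rewrite opprB mulr_natr mulr2n scalerDl addrK subrK.
rewrite rowE /H mulmxBr mulmx1 -scalemxAr mulmxA -rowE.
rewrite [row 0 w^T]mx11_scalar mul_scalar_mx scalerA !mxE w00.
by rewrite mulrA kc divff ?scale1r // pnatr_eq0.
Qed.

(** Induction on the size: conjugate by an orthogonal matrix whose first row is
    a unit eigenvector.  The first row of the result is then a multiple of the
    first basis vector, and so is the first column, by symmetry. *)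
Lemma orthogonal_diagonalization (R : rcfType) (n : nat) (A : 'M[R]_n) :
  A^T = A ->
  exists (P : 'M[R]_n) (d : 'rV[R]_n),
    P *m P^T = 1%:M /\ A = P^T *m diag_mx d *m P.
Proof.
elim: n A => [|n IHn] A symA.
  by exists 1%:M, 0; split; rewrite [LHS]flatmx0 [RHS]flatmx0.
have [a /eigenvalueP[u uA un0]] := symmetric_has_eigenvalue symA.
pose c := (u *m u^T) 0 0.
have c_gt0 : 0 < c by rewrite sqnorm_gt0.
pose v := (Num.sqrt c)^-1 *: u.
have vA : v *m A = a *: v by rewrite -scalemxAl uA !scalerA mulrC.
have /orthogonal_with_first_row[H [HH Hv]] : v *m v^T = 1%:M.
  rewrite /v linearZ /= -scalemxAl -scalemxAr scalerA [u *m _]mx11_scalar -/c.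
  by rewrite scale_scalar_mx -invfM -expr2 sqr_sqrtr ?ltW // mulVf ?gt_eqF.
pose A1 : 'M[R]_(1 + n) := H *m A *m H^T.
have symA1 : A1^T = A1 by rewrite /A1 !trmx_mul trmxK symA mulmxA.
have row0A1 : row 0 A1 = a *: delta_mx 0 0.
  rewrite /A1 row_mul [row 0 (H *m A)]row_mul Hv vA -scalemxAl -Hv.
  by rewrite -row_mul HH rowE mulmx1.
have AE : A = H^T *m A1 *m H.
  have HTH : H^T *m H = 1%:M by apply: mulmx1C.
  by rewrite /A1 !mulmxA HTH mul1mx -mulmxA HTH mulmx1.
clearbody A1; have ulA1 : ulsubmx A1 = a%:M.
  apply/matrixP => i j; rewrite !ord1 !mxE -[RHS]mulr1.
  have /rowP/(_ 0) := row0A1; rewrite !mxE eqxx /= => <-.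
  by congr (A1 _ _); apply: val_inj.
have urA1 : ursubmx A1 = 0.
  apply/matrixP => i j; rewrite !ord1 !mxE.
  have /rowP/(_ (rshift 1 j)) := row0A1; rewrite !mxE /= mulr0 => <-.
  by congr (A1 _ _); apply: val_inj.
have dlA1 : dlsubmx A1 = 0.
  by rewrite -[A1]symA1 -trmx_ursub urA1 trmx0.
have [|Q [d [QQ drA1]]] := IHn (drsubmx A1).
  by rewrite trmx_drsub symA1.
pose Q1 : 'M[R]_(1 + n) := block_mx 1%:M 0 0 Q.
have Q1Q1 : Q1 *m Q1^T = 1%:M.
  rewrite /Q1 tr_block_mx mulmx_block !trmx0 trmx1 QQ.
  by rewrite !(mulmx0, mul0mx, mulmx1, addr0, add0r) -scalar_mx_block.
pose d1 : 'rV[R]_(1 + n) := row_mx a%:M d.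
have A1E : A1 = Q1^T *m diag_mx d1 *m Q1.
  rewrite -[LHS]submxK ulA1 urA1 dlA1 drA1 /Q1 /d1 diag_mx_row tr_block_mx.
  rewrite !mulmx_block !trmx0 trmx1.
  rewrite !(mulmx0, mul0mx, mulmx1, mul1mx, addr0, add0r).
  by congr block_mx; apply/matrixP => i j; rewrite !ord1 !mxE.
exists (Q1 *m H), d1; split.
  by rewrite trmx_mul mulmxA -[Q1 *m H *m _]mulmxA HH mulmx1.
by rewrite AE A1E trmx_mul !mulmxA.
Qed.

(** * Eigenvalues of an orthogonally diagonalised matrix *)

Lemma char_poly_orthogonal (F : comUnitRingType) (n : nat) (P : 'M[F]_n)
    (d : 'rV[F]_n) :
  P *m P^T = 1%:M ->
  char_poly (P^T *m diag_mx d *m P) = \prod_(i < n) ('X - (d 0 i)%:P).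
Proof.
move=> PP; have PTP : P^T *m P = 1%:M by apply: mulmx1C.
pose f := map_mx (@polyC F).
transitivity (char_poly (diag_mx d)).
  rewrite /char_poly.
  have -> : char_poly_mx (P^T *m diag_mx d *m P)
            = f _ _ P^T *m char_poly_mx (diag_mx d) *m f _ _ P.
    rewrite /char_poly_mx mulmxBr mulmxBl -!map_mxM; congr (_ - _).
    by rewrite mul_mx_scalar -scalemxAl -map_mxM PTP map_mx1 scalemx1.
  rewrite !det_mulmx mulrC mulrA -det_mulmx /f -map_mxM PP.
  by rewrite map_mx1 det1 mul1r.
rewrite char_poly_trig ?diag_mx_is_trig //.
by apply: eq_bigr => i _; rewrite mxE eqxx mulr1n.
Qed.

(** Both sequences contain each [x] as often as its multiplicity in the
    characteristic polynomial. *)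
Lemma perm_eigenvalue_seq (R : realType) (n : nat) (A : 'M[R]_n) (s : seq R) :
  char_poly A = \prod_(x <- s) ('X - x%:P) -> perm_eq (eigenvalue_seq A) s.
Proof.
move=> chA; rewrite /eigenvalue_seq perm_sort.
apply/allP => x _ /=; apply/eqP; rewrite count_flatten sumnE !big_map.
rewrite -(mu_prod_XsubC x s) -chA.
set p := char_poly A; have pn0 : p != 0 by rewrite monic_neq0 ?char_poly_monic.
under eq_bigr do rewrite count_nseq /=.
have uniqr : uniq (rootsR p).
  apply: sorted_uniq (sorted_roots _ _ _); [exact: lt_trans | exact: ltxx].
have memr y : (y \in rootsR p) = root p y.
  by have := roots_on_rootsR pn0 y; rewrite !inE.
have [xr|xr] := boolP (x \in rootsR p).
  rewrite (bigD1_seq x) //= eqxx mul1n big1 ?addn0 // => y /negPf ->.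
  by rewrite mul0n.
rewrite mupNroot -?memr // big1_seq // => y /andP[_ yr].
by case: eqP => [yx|//]; rewrite -yx yr in xr.
Qed.

Lemma eigenvalues_orthogonal (R : realType) (n : nat) (P : 'M[R]_n)
    (d : 'rV[R]_n) :
  P *m P^T = 1%:M ->
  exists s : 'S_n,
    d = \row_i eigenvalues (P^T *m diag_mx d *m P) 0 (s i).
Proof.
move=> PP; set A := _ *m P.
have pe : perm_eq (eigenvalue_seq A) [seq d 0 i | i <- enum 'I_n].
  apply: perm_eigenvalue_seq.
  by rewrite char_poly_orthogonal // big_map big_enum.
have sz : size (eigenvalue_seq A) == n.
  by rewrite (perm_size pe) size_map size_enum_ord.
have /tuple_permP[s ds] : perm_eq [tuple d 0 i | i < n] (Tuple sz).
  by rewrite perm_sym.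
exists s; apply/rowP => i; rewrite !mxE.
have := congr1 (fun t => tnth t i) (val_inj ds : _ = [tuple _ | _ < n]).
by rewrite !tnth_mktuple (tnth_nth 0).
Qed.

(** * Positive semidefinite matrices *)

Lemma quad_congr_diagE (F : comNzRingType) (m n : nat) (B : 'M[F]_(n, m))
    (d : 'rV[F]_n) (x : 'rV[F]_m) :
  (x *m (B^T *m diag_mx d *m B) *m x^T) 0 0
  = \sum_i d 0 i * (x *m B^T) 0 i ^+ 2.
Proof.
have -> : x *m (B^T *m diag_mx d *m B) *m x^T
          = (x *m B^T) *m diag_mx d *m (x *m B^T)^T.
  by rewrite trmx_mul trmxK !mulmxA.
rewrite mxE; apply: eq_bigr => i _.
by rewrite mul_mx_diag !mxE mulrAC mulrC expr2.
Qed.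

(** One direction evaluates the form at an eigenvector; in the other the form
    is, by orthogonal diagonalisation, a sum of squares weighted by the
    eigenvalues. *)
Lemma psdP (R : realType) (n : nat) (A : 'M[R]_n) :
  psd A <-> A^T = A /\ forall x : 'rV[R]_n, 0 <= (x *m A *m x^T) 0 0.
Proof.
split=> [[/symmetricmxP symA eigA]|[symA quadA]]; split=> //; last 1 first.
- move=> a /eigenvalueP[x xA xn0]; have := quadA x.
  rewrite xA -scalemxAl mxE => ax; rewrite leNgt; apply/negP => a_lt0.
  by move: ax; rewrite nmulr_rge0 // leNgt sqnorm_gt0.
- move=> x; have [P [d [PP AE]]] := orthogonal_diagonalization symA.
  rewrite AE quad_congr_diagE; apply: sumr_ge0 => i _.
  rewrite mulr_ge0 ?sqr_ge0 //; apply: eigA.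
  rewrite eigenvalue_root_char AE char_poly_orthogonal // rootE horner_prod.
  by rewrite (bigD1 i) //= hornerXsubC subrr mul0r.
exact/symmetricmxP.
Qed.

(** Submatrices as products, so that a quadratic form restricted to a set of
    coordinates is the original form at a vector extended by zeros. *)
Lemma mxsubE_mul (F : pzRingType) (m n p q : nat) (f : 'I_p -> 'I_m)
    (g : 'I_q -> 'I_n) (A : 'M[F]_(m, n)) :
  mxsub f g A = rowsub f 1%:M *m A *m colsub g 1%:M.
Proof.
rewrite mul_rowsub_mx mul1mx mulmx_colsub mulmx1.
by apply/matrixP => i j; rewrite !mxE.
Qed.

Lemma locally_psdD (R : realType) (n k : nat) (A B : 'M[R]_n) :
  locally_psd k A -> psd B -> locally_psd k (A + B).
Proof.
move=> [/symmetricmxP symA locA] /psdP[symB quadB]; split.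
  by apply/symmetricmxP; rewrite linearD /= symA symB.
move=> I cardI; have /psdP[symAI quadAI] := locA I cardI.
apply/psdP; split.
  by rewrite /principal_submx trmx_mxsub linearD /= symA symB.
move=> x.
have -> : principal_submx I (A + B) = principal_submx I A + principal_submx I B.
  by apply/matrixP => i j; rewrite !mxE.
rewrite mulmxDr mulmxDl mxE addr_ge0 //.
rewrite [principal_submx I B]mxsubE_mul.
set f := @enum_val _ _.
have -> : colsub f 1%:M = (rowsub f 1%:M)^T :> 'M[R]_(n, #|I|).
  by rewrite trmx_mxsub trmx1.
by rewrite !mulmxA -mulmxA -trmx_mul quadB.
Qed.

Lemma psd_congr_diag (R : realType) (m n : nat) (P : 'M[R]_(n, m))
    (d : 'rV[R]_n) :
  nonneg_orthant d -> psd (P^T *m diag_mx d *m P).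
Proof.
move=> d_ge0; apply/psdP; split.
  by rewrite !trmx_mul trmxK tr_diag_mx mulmxA.
move=> x; rewrite quad_congr_diagE; apply: sumr_ge0 => i _.
by rewrite mulr_ge0 ?sqr_ge0 //; apply: d_ge0.
Qed.

(** * Raising the eigenvalues of a locally positive semidefinite matrix *)

Theorem proposition1p3 (R : realType) (n k : nat)
    (hn : (1 <= n)%N) (hk : (1 <= k <= n)%N) (l lp : 'rV[R]_n) :
  eigenvalue_set (@locally_psd R n k) l ->
  @nonneg_orthant R n lp ->
  eigenvalue_set (@locally_psd R n k) (l + lp).
Proof.
move=> [X [s [locX lE]]] lp_ge0.
have [/symmetricmxP symX _] := locX.
have [P [d [PP XE]]] := orthogonal_diagonalization symX.
have [s1 dE] := eigenvalues_orthogonal d PP; rewrite -XE in dE.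
(* [s] orders the decreasing eigenvalues as in [l], and [s1] orders them as in
   [d]; hence [t] takes the positions of [l] to those of [d]. *)
pose t := (s * s1^-1)%g.
have lt i : l 0 i = d 0 (t i) by rewrite lE dE !mxE permM permKV.
pose e : 'rV[R]_n := \row_i lp 0 ((t^-1)%g i).
have [s2 deE] := eigenvalues_orthogonal (d + e) PP.
exists (P^T *m diag_mx (d + e) *m P), (t * s2)%g; split.
  rewrite linearD /= mulmxDr mulmxDl -XE; apply: locally_psdD => //.
  by apply: psd_congr_diag => i; rewrite mxE; apply: lp_ge0.
apply/rowP => i; transitivity ((d + e) 0 (t i)).
  by rewrite !mxE lt permK.
by rewrite [in LHS]deE !mxE [in RHS]permM.
Qed.
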